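(* Let $r>0$ and let $f\in\Gamma_0(\mathbb{R}^n)$. Then $f$ is a generalized linear-quadratic function if and only if $e_rf\in\Gamma_0(\mathbb{R}^n)$ is a quadratic function. Specifically, for $A\in S^n_+$, $b\in\mathbb{R}^n$, $c\in\mathbb{R}$, one has $$e_rf(x)=\tfrac{1}{2}\langle x,Ax\rangle+\langle b,x\rangle+c\qquad\forall x\in\mathbb{R}^n$$ if and only if $$f(x)=q_{(A^{-1}-\operatorname{Id}/r)^{-1}}\Big(x+\frac{b}{r}\Big)+\langle b,x\rangle+c+\frac{1}{2r}\|b\|^2\qquad\forall x\in\mathbb{R}^n.$$
   Context: $\Gamma_0(\mathbb{R}^n)$ is the set of proper, convex, lower semicontinuous functions $\mathbb{R}^n\to\mathbb{R}\cup\{\infty\}$; $S^n_+$ is the set of symmetric positive semidefinite $n\times n$ real matrices. For a proper lsc $f$ and $r>0$, the Moreau envelope is $e_rf(x)=\inf_{y\in\mathbb{R}^n}\{f(y)+\frac r2\|y-x\|^2\}$. A linear relation is a set-valued operator $A:\mathbb{R}^n\rightrightarrows\mathbb{R}^n$ whose graph $\operatorname{gra}A=\{(x,x^* ):x^*\in Ax\}$ is a linear subspace of $\mathbb{R}^n\times\mathbb{R}^n$; its (set-valued) inverse $A^{-1}$ has graph $\{(x^*,x):x^*\in Ax\}$, and sums/scalar multiples of operators are taken pointwise (Minkowski sums of sets). An operator $A$ is monotone if $\langle x^*-y^*,x-y\rangle\ge0$ for all $(x,x^* ),(y,y^* )\in\operatorname{gra}A$. For a monotone linear relation $A$, $q_A(x)=\frac12\langle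 x,Ax\rangle$ if $x\in\operatorname{dom}A$ (this value is single-valued) and $q_A(x)=\infty$ otherwise. A generalized linear-quadratic function is a function of the form $p(x)=\frac12\langle x-a,A(x-a)\rangle+\langle b,x\rangle+c$ (with value $\infty$ when $x-a\notin\operatorname{dom}A$), where $A$ is a linear relation, $a,b\in\mathbb{R}^n$, $c\in\mathbb{R}$. All inverses above are set-valued inverses. *)

(* Defs.v *)
From HB Require Import structures.
From mathcomp Require Import all_boot all_order all_algebra.
From mathcomp Require Import all_classical all_reals all_analysis.
Set Implicit Arguments. Unset Strict Implicit. Unset Printing Implicit Defensive.
Import Order.TTheory GRing.Theory Num.Theory.
Import numFieldNormedType.Exports.
Local Open Scope ring_scope.

Section Defs.
Context {R : realType} {n : nat}.
Local Notation V := 'cV[R]_n.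

Definition dotv (x y : V) : R := \sum_(i < n) x i 0 * y i 0.
Definition sqnorm (x : V) : R := dotv x x.

Definition proper_fun (f : V -> \bar R) : Prop :=
  (forall x, f x != -oo%E) /\ (exists x, f x != +oo%E).
Definition convex_fun (f : V -> \bar R) : Prop :=
  forall (x y : V) (t : R), 0 < t < 1 ->
    (f (t *: x + (1 - t) *: y)%R <= t%:E * f x + (1 - t)%:E * f y)%E.
Definition Gamma0 (f : V -> \bar R) : Prop :=
  proper_fun f /\ convex_fun f /\ lower_semicontinuous f.

Definition moreau_env (r : R) (f : V -> \bar R) (x : V) : \bar R :=
  ereal_inf [set (f y + ((r / 2) * sqnorm (y - x))%:E)%E | y in [set: V]].

Definition sym_psd (A : 'M[R]_n) : Prop :=
  A^T = A /\ forall x : V, 0 <= dotv x (A *m x).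

(* set-valued operators R^n ==> R^n, given by their graphs: G x x' <-> x' \in G x *)
Definition relation := V -> V -> Prop.
Definition linear_relation (G : relation) : Prop :=
  G 0 0 /\ (forall x x' y y', G x x' -> G y y' -> G (x + y) (x' + y')) /\
  (forall (a : R) x x', G x x' -> G (a *: x) (a *: x')).
Definition monotone_rel (G : relation) : Prop :=
  forall x x' y y', G x x' -> G y y' -> 0 <= dotv (x' - y') (x - y).
Definition mx_rel (A : 'M[R]_n) : relation := fun x x' => x' = A *m x.
Definition rel_inv (G : relation) : relation := fun x x' => G x' x.
Definition rel_add (G H : relation) : relation :=
  fun x z => exists y1 y2, G x y1 /\ H x y2 /\ z = y1 + y2.
Definition rel_scale (a : R) (G : relation) : relation :=
  fun x z => exists y, G x y /\ z = a *: y.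
Definition rel_id : relation := fun x x' => x' = x.

(* q_G x = 1/2 <x, x'> for x' \in G x if x \in dom G, and +oo otherwise.
   (For the relations used below the value does not depend on the choice
   of x'.) *)
Definition qrel (G : relation) (x : V) : \bar R :=
  match pselect (exists x', G x x') with
  | left h => ((1 / 2) * dotv x (projT1 (cid h)))%:E
  | right _ => +oo%E
  end.

Definition gen_lin_quad (f : V -> \bar R) : Prop :=
  exists (G : relation) (a b : V) (c : R),
    linear_relation G /\ monotone_rel G /\
    forall x, f x = (qrel G (x - a) + (dotv b x + c)%:E)%E.

Definition quad_fun (A : 'M[R]_n) (b : V) (c : R) (x : V) : R :=
  (1 / 2) * dotv x (A *m x) + dotv b x + c.

End Defs.

(* Main.v *)
Require Import Defs.
From HB Require Import structures.
From mathcomp Require Import all_boot all_order all_algebra.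
From mathcomp Require Import all_classical all_reals all_analysis.
From mathcomp Require Import ring lra.
Import Order.TTheory GRing.Theory Num.Theory.
Import numFieldNormedType.Exports.
Local Open Scope ring_scope.

(** Write [T = Id - A/r], so that the graph of [(A^-1 - Id/r)^-1] is
    [{(T z, A z)}], and [proxv z = T z - b/r].  For the candidate [f], completing
    the square shows that the objective defining [e_r f x], evaluated at
    [proxv z], exceeds the quadratic at [x] by [r/2 <z - x, T (z - x)>]; convexity
    of [f] forces [T >= 0], hence the envelope is the quadratic.

    Conversely, if [e_r f] is the quadratic, approximate minimisers at [x] converge
    to [proxv x], so lower semicontinuity gives the value of [f] on the range of
    [proxv]; off this range, [f y >= e_r f x - r/2 |y - x|^2] is unbounded along a
    kernel direction of [T], so [f y = +oo].

    For a general monotone linear relation, parametrise its domain by an injective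
    matrix [P] and a linear selection by [P'].  The envelope is then the minimum of
    a positive definite quadratic in the parameter, hence quadratic. *)

(** * Inner product, and the range of a symmetric matrix *)

Section DotProduct.
Context {R : realType}.

Lemma dotvC {n} (x y : 'cV[R]_n) : dotv x y = dotv y x.
Proof. by apply: eq_bigr => i _; rewrite mulrC. Qed.

Lemma dotvDl {n} (x y z : 'cV[R]_n) : dotv (x + y) z = dotv x z + dotv y z.
Proof. by rewrite /dotv -big_split; apply: eq_bigr => i _; rewrite mxE mulrDl. Qed.

Lemma dotvZl {n} a (x z : 'cV[R]_n) : dotv (a *: x) z = a * dotv x z.
Proof. by rewrite /dotv mulr_sumr; apply: eq_bigr => i _; rewrite mxE mulrA. Qed.

Lemma dotvNl {n} (x z : 'cV[R]_n) : dotv (- x) z = - dotv x z.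
Proof. by rewrite -scaleN1r dotvZl mulN1r. Qed.

Lemma dotvDr {n} (x y z : 'cV[R]_n) : dotv z (x + y) = dotv z x + dotv z y.
Proof. by rewrite dotvC dotvDl !(dotvC z). Qed.

Lemma dotvZr {n} a (x z : 'cV[R]_n) : dotv z (a *: x) = a * dotv z x.
Proof. by rewrite dotvC dotvZl dotvC. Qed.

Lemma dotvNr {n} (x z : 'cV[R]_n) : dotv z (- x) = - dotv z x.
Proof. by rewrite dotvC dotvNl dotvC. Qed.

Definition dotvE {n} :=
  (@dotvDl n, @dotvDr n, @dotvNl n, @dotvNr n, @dotvZl n, @dotvZr n).

Lemma dotv0l {n} (x : 'cV[R]_n) : dotv 0 x = 0.
Proof. by rewrite -(scale0r 0) dotvZl mul0r. Qed.

Lemma dotv0r {n} (x : 'cV[R]_n) : dotv x 0 = 0.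
Proof. by rewrite dotvC dotv0l. Qed.

Lemma dotv_mulmxE {n} (x y : 'cV[R]_n) : x^T *m y = (dotv x y)%:M.
Proof.
by rewrite [LHS]mx11_scalar mxE; congr (_%:M); apply: eq_bigr => i _; rewrite mxE.
Qed.

Lemma dotv_mulmxl {m n} (A : 'M[R]_(m, n)) (x : 'cV[R]_n) (y : 'cV[R]_m) :
  dotv (A *m x) y = dotv x (A^T *m y).
Proof.
have /matrixP/(_ 0 0) : (dotv (A *m x) y)%:M = (dotv x (A^T *m y))%:M :> 'M[R]_1.
  by rewrite -!dotv_mulmxE trmx_mul mulmxA.
by rewrite !mxE !mulr1n.
Qed.

Lemma dotv_ge0 {n} (x : 'cV[R]_n) : 0 <= dotv x x.
Proof. by apply: sumr_ge0 => i _; rewrite -expr2 sqr_ge0. Qed.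

Lemma dotv_eq0 {n} (x : 'cV[R]_n) : dotv x x = 0 -> x = 0.
Proof.
move=> x0; apply/matrixP => i j; rewrite ord1 mxE.
have : x i 0 * x i 0 = 0.
  by apply: (psumr_eq0P _ x0) => // k _; rewrite -expr2 sqr_ge0.
by move/eqP; rewrite mulf_eq0 orbb => /eqP.
Qed.

Lemma sqr_coord_le_dotv {n} (x : 'cV[R]_n) i : x i 0 ^+ 2 <= dotv x x.
Proof.
rewrite /dotv (bigD1 i) //= expr2 lerDl.
by apply: sumr_ge0 => k _; rewrite -expr2 sqr_ge0.
Qed.

(** By symmetry [v] lies in the range of [B] iff [v^T] lies in its row space. Failure of the latter
    is detected by a column of [cokermx B], and [B] kills all these columns. *)
Lemma sym_ker_orth_image {n} (B : 'M[R]_n) (v : 'cV[R]_n) : B^T = B ->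
  ~ (exists z, v = B *m z) -> exists2 k, B *m k = 0 & dotv k v != 0.
Proof.
move=> symB vNB; have : ~~ (v^T <= B)%MS.
  apply/negP => /submxP[D vD]; apply: vNB; exists D^T.
  by rewrite -[v]trmxK vD trmx_mul symB.
rewrite submxE => /eqP vC.
have [[j vj]|vC0] := pselect (exists j, (v^T *m cokermx B) 0 j != 0); last first.
  case: vC; apply/matrixP => i j; rewrite ord1 [RHS]mxE; apply/eqP.
  by apply/negPn/negP => vj; apply: vC0; exists j.
exists (col j (cokermx B)); first by rewrite colE mulmxA mulmx_coker mul0mx.
move: vj; congr (~~ (_ == _)).
rewrite mxE; apply: eq_bigr => i _.
by rewrite !mxE mulrC.
Qed.

End DotProduct.

(** * Continuity of quadratic functions *)

Section Continuity.
Context {R : realType} {n : nat}.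
Local Notation V := 'cV[R]_n.

Lemma continuous_dotv (g h : V -> V) :
  (forall i, continuous (fun x => g x i 0)) ->
  (forall i, continuous (fun x => h x i 0)) ->
  continuous (fun x => dotv (g x) (h x)).
Proof.
move=> cg ch x.
apply: (cvg_big (@add_continuous R) (Ff := fun i y => g y i 0 * h y i 0)
  (nbhs_filter x)) => i _.
by apply: cvgM; [exact: cg | exact: ch].
Qed.

Lemma continuous_dotv_cst (b : V) : continuous (dotv b).
Proof.
apply: (@continuous_dotv (fun=> b) id) => i; last exact: coord_continuous.
exact: cst_continuous.
Qed.

Lemma continuous_quad_fun (A : 'M[R]_n) (b : V) (c : R) :
  continuous (quad_fun A b c).
Proof.
have cA : continuous (fun x : V => dotv x (A *m x)).
  apply: (@continuous_dotv id (mulmx A)) => i; first exact: coord_continuous.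
  rewrite (_ : (fun y => _) = dotv (row i A)^T); first exact: continuous_dotv_cst.
  by apply/funext => y; rewrite mxE; apply: eq_bigr => j _; rewrite !mxE.
move=> x; pose q (y : V) := 1 / 2 * dotv y (A *m y).
apply: (@continuousD _ _ _ (fun y => q y + dotv b y) (fun=> c)); last first.
  exact: cst_continuous.
apply: (@continuousD _ _ _ q (dotv b)); last exact: continuous_dotv_cst.
apply: (@continuousM _ _ (fun=> 1 / 2) (fun y => dotv y (A *m y))).
  exact: cst_continuous.
exact: cA.
Qed.

Lemma continuous_lsc (g : V -> R) :
  continuous g -> lower_semicontinuous (fun x => (g x)%:E).
Proof.
move=> cg x a; rewrite lte_fin => agx.
exists [set y : V | a < g y]%classic => [|y /=]; last by rewrite lte_fin.
exact: (cg x [set t | a < t]%classic (lt_nbhsr agx)).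
Qed.

End Continuity.

(** * Bounds on the envelope, and well-definedness of [qrel] *)

Section MoreauEnvelope.
Context {R : realType} {n : nat}.
Local Notation V := 'cV[R]_n.
Implicit Types (f : V -> \bar R) (G : @relation R n) (x y : V).

Lemma moreau_env_le r f x y :
  (moreau_env r f x <= f y + ((r / 2) * sqnorm (y - x))%:E)%E.
Proof. by apply: ereal_inf_lbound; exists y. Qed.

Lemma moreau_env_eq r f x (q : R) :
  (forall y, (q%:E <= f y + ((r / 2) * sqnorm (y - x))%:E)%E) ->
  (exists y, (f y + ((r / 2) * sqnorm (y - x))%:E)%E = q%:E) ->
  moreau_env r f x = q%:E.
Proof.
move=> qle [y yq]; apply/eqP; rewrite eq_le -{1}yq moreau_env_le /=.
by apply/ereal_infP => _ [z _ <-]; exact: qle.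
Qed.

Lemma qrel_dom G x x' :
  (forall x1 x2, G x x1 -> G x x2 -> dotv x x1 = dotv x x2) ->
  G x x' -> qrel G x = ((1 / 2) * dotv x x')%:E.
Proof.
move=> uniq Gxx'; rewrite /qrel; case: pselect => [h|[]]; last by exists x'.
by rewrite (uniq _ x' (projT2 (cid h)) Gxx').
Qed.

Lemma qrel_out G x : ~ (exists x', G x x') -> qrel G x = +oo%E.
Proof. by move=> nG; rewrite /qrel; case: pselect. Qed.

Lemma monotone_dotv_uniq G x x1 x2 : linear_relation G -> monotone_rel G ->
  G x x1 -> G x x2 -> dotv x x1 = dotv x x2.
Proof.
move=> [G0 [GD GZ]] Gmon G1 G2.
(* [v := x1 - x2] lies in [G 0], so [0 <= <x1 + t v, x>] for every [t] *)
have Gv : G 0 (x1 - x2).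
  by rewrite -(subrr x) -!(scaleN1r x) -(scaleN1r x2); apply: GD => //; apply: GZ.
have lin (t : R) : 0 <= dotv x x1 + t * (dotv x x1 - dotv x x2).
  have := Gmon _ _ _ _ (GD _ _ _ _ G1 (GZ t _ _ Gv)) G0.
  by rewrite !subr0 scaler0 addr0 !dotvE !(dotvC x) => h.
set u := dotv x x1 - dotv x x2.
apply/eqP; rewrite -subr_eq0 -/u; apply/negPn/negP => u0.
have := lin (- (dotv x x1 + 1) / u); rewrite -/u divfK // => h; lra.
Qed.

End MoreauEnvelope.

(** * The explicit correspondence between [f] and a quadratic envelope *)

Section QuadraticEnvelope.
Context {R : realType} {n : nat}.
Local Notation V := 'cV[R]_n.
Variables (r : R) (A : 'M[R]_n) (b : V) (c : R) (f : V -> \bar R).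
Hypotheses (r0 : 0 < r) (symA : A^T = A).

Local Notation G := (rel_inv (rel_add (rel_inv (mx_rel A))
                                      (rel_scale (- r^-1) rel_id))).
Local Notation T z := (z - r^-1 *: (A *m z)).
Local Notation proxv z := (T z - r^-1 *: b).
Local Notation quad_env :=
  (forall x, moreau_env r f x = (quad_fun A b c x)%:E).
Local Notation genquad :=
  (forall x, f x = (qrel G (x + r^-1 *: b)
                    + (dotv b x + c + (1 / (2 * r)) * sqnorm b)%:E)%E).

Let rn0 : r != 0. Proof. by rewrite gt_eqF. Qed.

Let symE (x y : V) : dotv (A *m x) y = dotv x (A *m y).
Proof. by rewrite dotv_mulmxl symA. Qed.

(** Membership means that [x + x'/r] is a preimage of [x'] under [A]; this preimage is the parameter
    [z]. *)
Lemma res_relP (x x' : V) : G x x' <-> exists2 z, x = T z & x' = A *m z.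
Proof.
split=> [[z [_ [-> [[_ [-> ->]] ->]]]]|[z -> ->]].
  by exists z => //; rewrite scaleNr.
exists z, (- (r^-1 *: (A *m z))); split=> //; split=> //.
by exists (A *m z); rewrite scaleNr.
Qed.

Lemma res_rel_linear : linear_relation G.
Proof.
split; first by apply/res_relP; exists 0; rewrite !mulmx0 ?scaler0 ?subr0.
split=> [x x' y y' /res_relP[z -> ->] /res_relP[w -> ->]
        |a x x' /res_relP[z -> ->]].
  by apply/res_relP; exists (z + w); rewrite mulmxDr // scalerDr opprD addrACA.
apply/res_relP; exists (a *: z); rewrite -scalemxAr //.
by rewrite scalerBr !scalerA mulrC.
Qed.

(** Two parameters of the same point differ by some [w] with [T w = 0], that is [A w = r w]. Since
    [T] is symmetric, its range is orthogonal to [w], so the value does not depend on the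
    parameter. *)
Lemma qrel_res_rel (z : V) : qrel G (T z) = ((1 / 2) * dotv (T z) (A *m z))%:E.
Proof.
apply: qrel_dom; last by apply/res_relP; exists z.
move=> _ _ /res_relP[z1 Tz1 ->] /res_relP[z2 Tz2 ->].
apply/eqP; rewrite -subr_eq0 -dotvNr -dotvDr -mulmxBr; set w := z1 - z2.
have Aw : A *m w = r *: w.
  have : T w = 0.
    have -> : T w = T z1 - T z2 by rewrite mulmxBr scalerBr !opprD addrACA.
    by rewrite -Tz1 Tz2 subrr.
  by move/eqP; rewrite subr_eq0 => /eqP {2}->; rewrite scalerA divff // scale1r.
rewrite !dotvE symE Aw -scalemxAr Aw !dotvE.
by apply/eqP; field.
Qed.

(* Up to a square, the objective at [proxv z] is the envelope at [x]:
   it is minimal at [z = x] as soon as [A <= r Id]. *)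
Lemma prox_objective (x z : V) :
  (1 / 2) * dotv (T z) (A *m z)
    + (dotv b (proxv z) + c + (1 / (2 * r)) * sqnorm b)
    + r / 2 * sqnorm (proxv z - x)
  = quad_fun A b c x + r / 2 * dotv (z - x) (T (z - x)).
Proof.
rewrite /quad_fun /sqnorm mulmxBr.
have xAz : dotv x (A *m z) = dotv z (A *m x) by rewrite dotvC symE.
move: xAz; move: (A *m z) (A *m x) => Az Ax xAz.
rewrite !dotvE.
rewrite !(dotvC Az) !(dotvC _ z) !(dotvC _ b) !(dotvC _ x) xAz.
by field.
Qed.

(** Convexity is applied at [proxv z] and [proxv (- z)], whose midpoint is [proxv 0]. The affine
    terms cancel, and the quadratic part is even and vanishes at [T 0]. *)
Lemma convex_res_monotone (z : V) : convex_fun f -> genquad ->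
  0 <= dotv (T z) (A *m z).
Proof.
move=> cf fE.
have h : 0 < (2^-1 : R) < 1 by lra.
have TN : T (- z) = - T z by rewrite mulmxN scalerN opprB opprK addrC.
have := cf (proxv z) (proxv (- z)) _ h; rewrite !fE !addrNK.
have -> : 2^-1 *: proxv z + (1 - 2^-1) *: proxv (- z) + r^-1 *: b = T 0.
  rewrite TN mulmx0 scaler0 subr0; move: (T z) (r^-1 *: b) => u v.
  by apply/matrixP => i j; rewrite !mxE; field.
rewrite !qrel_res_rel TN -!EFinD.
rewrite lee_fin mulmx0 mulmxN.
rewrite dotv0r !dotvE; lra.
Qed.

(** Splitting [w] as [T w + A w / r] turns the form into a square plus a positive multiple of the
    monotonicity term. *)
Lemma res_monotone_le_id (w : V) :
  (forall z, 0 <= dotv (T z) (A *m z)) -> 0 <= dotv w (T w).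
Proof.
move=> mon; rewrite (_ : dotv w (T w) =
  dotv (T w) (T w) + r^-1 * dotv (T w) (A *m w)); last first.
  by rewrite -dotvZr -dotvDr addrNK dotvC.
by rewrite addr_ge0 ?dotv_ge0 // mulr_ge0 // invr_ge0 ltW.
Qed.

Lemma genquad_moreau_env : convex_fun f -> genquad -> quad_env.
Proof.
move=> cf fE x.
have psd w : 0 <= dotv w (T w).
  by apply: res_monotone_le_id => z; apply: convex_res_monotone.
have objE z : (f (proxv z) + ((r / 2) * sqnorm (proxv z - x))%:E)%E =
    (quad_fun A b c x + r / 2 * dotv (z - x) (T (z - x)))%:E.
  by rewrite fE addrNK qrel_res_rel -!EFinD prox_objective.
apply: moreau_env_eq => [y|]; last first.
  by exists (proxv x); rewrite objE subrr dotv0l mulr0 addr0.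
have [[x' /res_relP[z yE _]]|yN] := pselect (exists x', G (y + r^-1 *: b) x').
  have -> : y = proxv z by rewrite -yE addrK.
  by rewrite objE lee_fin lerDl mulr_ge0 // divr_ge0 // ltW.
by rewrite fE qrel_out // !addye // leey.
Qed.


Lemma quad_funD (x d : V) : quad_fun A b c (x + d) =
  quad_fun A b c x + dotv (A *m x + b) d + 1 / 2 * dotv d (A *m d).
Proof.
rewrite /quad_fun mulmxDr !dotvE symE (dotvC d (A *m x)) symE.
by field.
Qed.

(** The value [-oo] is excluded because it would force the finite envelope down to [-oo]. *)
Lemma quad_env_bound (y : V) : quad_env -> f y != +oo%E -> exists2 v : R,
  f y = v%:E & forall x, quad_fun A b c x <= v + r / 2 * sqnorm (y - x).
Proof.
move=> eE; case E: (f y) => [v||] // _.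
  by exists v => // w; have := moreau_env_le r f w y; rewrite eE E -EFinD lee_fin.
by have := moreau_env_le r f 0 y; rewrite eE E.
Qed.

(* An approximate minimiser of the objective at [x] is close to [proxv x]:
   test the upper bound that [f z] puts on the envelope at
   [x + (z - proxv x)]. *)
Lemma near_prox (x z : V) (e : R) : (forall x, 0 <= dotv x (A *m x)) ->
  quad_env ->
  (f z + (r / 2 * sqnorm (z - x))%:E < (quad_fun A b c x + e)%:E)%E ->
  r / 2 * sqnorm (z - proxv x) < e.
Proof.
move=> psd eE zlt.
have [v fz vle] : exists2 v : R, f z = v%:E &
    forall x, quad_fun A b c x <= v + r / 2 * sqnorm (z - x).
  by apply: (quad_env_bound z eE); apply: contraTneq zlt => ->.
move: zlt; rewrite fz -EFinD lte_fin; set d := z - proxv x.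
have := vle (x + d); rewrite quad_funD; have := psd d.
set m := r^-1 *: (A *m x + b).
have -> : A *m x + b = r *: m by rewrite scalerA divff // scale1r.
have pE : proxv x = x - m by rewrite /m scalerDr opprD addrA.
have -> : z - (x + d) = - m.
  by rewrite /d pE; apply/matrixP => i j; rewrite !mxE; ring.
have -> : z - x = d - m.
  by rewrite /d pE; apply/matrixP => i j; rewrite !mxE; ring.
clearbody d m; rewrite /sqnorm !dotvE (dotvC d m); lra.
Qed.

(** Otherwise lower semicontinuity keeps [f] above some [a] exceeding the bound near [proxv x].
    Approximate minimisers land there by [near_prox], and their objective is then too large. *)
Lemma moreau_env_prox_le (x : V) : (forall x, 0 <= dotv x (A *m x)) ->
  lower_semicontinuous f -> quad_env ->
  (f (proxv x) <= (quad_fun A b c x - r / 2 * sqnorm (proxv x - x))%:E)%E.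
Proof.
move=> psd lscf eE; rewrite leNgt; apply/negP; set L := _ - _ => Lf.
have [a La af] : exists2 a, L < a & (a%:E < f (proxv x))%E.
  move: Lf; case: (f _) => [v||] //; rewrite ?lte_fin => Lv.
    by exists ((L + v) / 2); rewrite ?lte_fin; lra.
  by exists (L + 1); rewrite ?ltry //; lra.
have [U nU Uf] := lscf _ _ af.
(* The penalty is written as a quadratic function, whose continuity is known. *)
pose h := quad_fun (r%:M) (- (r *: x)) (r / 2 * sqnorm x).
have hE z : r / 2 * sqnorm (z - x) = h z.
  by rewrite /h /quad_fun /sqnorm mul_scalar_mx !dotvE (dotvC z x); field.
pose eta := (a - L) / 2.
have [W nW Wh] : exists2 W, nbhs (proxv x) W &
    forall y, W y -> ((h (proxv x) - eta)%:E < (h y)%:E)%E.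
  apply: (continuous_lsc _ (continuous_quad_fun _ _ _)).
  by rewrite lte_fin /eta /h; lra.
have nUW : nbhs (proxv x) (U `&` W)%classic by exact: filterI.
have [del /= del0 UW] := (nbhs_ballP _ _).1 nUW.
(* The gap [a - L] is shared equally between the variation of [h] and the suboptimality [e]. The
   second bound on [e] puts the approximate minimiser within [del] of [proxv x]. *)
pose e := Num.min eta (r * del ^+ 2 / 4).
have e0 : 0 < e.
  rewrite lt_min; apply/andP; split; first by rewrite /eta; lra.
  by rewrite !divr_gt0 ?mulr_gt0 ?exprn_gt0.
have [_ [z _ <-] zlt] : exists2 t,
    [set (f y + (r / 2 * sqnorm (y - x))%:E)%E | y in [set: V]]%classic t
    & (t < (quad_fun A b c x + e)%:E)%E.
  by apply: ereal_inf_lt; rewrite -/(moreau_env r f x) eE lte_fin ltrDl.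
have dz := near_prox x z e psd eE zlt.
have [/Uf fz /Wh hz] : U z /\ W z.
  apply: UW; split=> // i j; rewrite /ball /= ord1.
  have cE (p : V) : p i 0 - z i 0 = - (z - p) i 0 by rewrite !mxE opprB.
  rewrite -(ltr_pXn2r (n := 2)) ?nnegrE ?normr_ge0 ?(ltW del0) //.
  rewrite cE normrN real_normK ?num_real //.
  apply: le_lt_trans (sqr_coord_le_dotv _ _) _.
  have edel : e <= r * del ^+ 2 / 4 by rewrite ge_min lexx orbT.
  have rdel : 0 < r * del ^+ 2 by rewrite mulr_gt0 ?exprn_gt0.
  have r20 : 0 < r / 2 by rewrite divr_gt0.
  rewrite -(ltr_pM2l r20); move: dz; rewrite /sqnorm; lra.
move: zlt fz hz; rewrite hE !lte_fin.
have : e <= eta by rewrite ge_min lexx.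
rewrite -hE.
case: (f z) => [v||] //; rewrite -?EFinD ?lte_fin /eta /L -?hE; lra.
Qed.

Lemma moreau_env_genquad : (forall x, 0 <= dotv x (A *m x)) ->
  lower_semicontinuous f -> quad_env -> genquad.
Proof.
move=> psd lscf eE y.
have [[x' /res_relP[z yE _]]|yN] := pselect (exists x', G (y + r^-1 *: b) x').
  have -> : y = proxv z by rewrite -yE addrK.
  rewrite addrNK qrel_res_rel -EFinD.
  (* At [x = z] the excess vanishes, so the candidate value is the envelope at [z] minus the
     penalty. [moreau_env_prox_le] gives one inequality, the definition of the envelope the
     other. *)
  have objE := prox_objective z z; rewrite subrr dotv0l mulr0 addr0 in objE.
  rewrite -[X in _ = X%:E](addrK (r / 2 * sqnorm (proxv z - z))) objE.
  apply/eqP; rewrite eq_le moreau_env_prox_le //=.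
  have := moreau_env_le r f z (proxv z); rewrite eE.
  by case: (f _) => [v||] //; rewrite ?leey // -EFinD !lee_fin; lra.
rewrite qrel_out // addye //; apply/eqP/negPn/negP.
move=> /(quad_env_bound y eE)[v fy vle].
pose B := 1%:M - r^-1 *: A.
have BE z : B *m z = T z by rewrite mulmxBl mul1mx -scalemxAl.
have [k Bk ky] : exists2 k, B *m k = 0 & dotv k (y + r^-1 *: b) != 0.
  apply: sym_ker_orth_image.
    by rewrite /B linearB linearZ /= symA trmx1.
  move=> [z yz]; apply: yN; exists (A *m z); apply/res_relP; exists z => //.
  by rewrite yz BE.
have Ak : A *m k = r *: k.
  move: Bk; rewrite BE => /eqP; rewrite subr_eq0 => /eqP {2}->.
  by rewrite scalerA divff // scale1r.
(* along [k] the quadratic terms cancel, so the bound on [f y] is affine *)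
pose s := dotv k (y + r^-1 *: b); pose K := v - c + r / 2 * sqnorm y.
have lin t : t * (r * s) <= K.
  have := vle (t *: k).
  rewrite /quad_fun -scalemxAr Ak /K /s /sqnorm !dotvE (dotvC y k) (dotvC b k).
  have -> : r * (dotv k y + r^-1 * dotv k b) = r * dotv k y + dotv k b by field.
  lra.
(* This choice of [t] makes the left-hand side [K + 1]. *)
have := lin ((K + 1) / (r * s)); rewrite divfK ?mulf_neq0 //; lra.
Qed.

End QuadraticEnvelope.

(** * Convexity of a quadratic and semidefiniteness of its matrix *)

Section QuadraticGamma0.
Context {R : realType} {n : nat}.
Local Notation V := 'cV[R]_n.
Variables (A : 'M[R]_n) (b : V) (c : R).
Hypothesis symA : A^T = A.

Let symE (x y : V) : dotv (A *m x) y = dotv x (A *m y).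
Proof. by rewrite dotv_mulmxl symA. Qed.

Lemma quad_fun_convex_comb (x y : V) (t : R) :
  t * quad_fun A b c x + (1 - t) * quad_fun A b c y
  = quad_fun A b c (t *: x + (1 - t) *: y)
    + t * (1 - t) / 2 * dotv (x - y) (A *m (x - y)).
Proof.
have yAx : dotv y (A *m x) = dotv x (A *m y) by rewrite dotvC symE.
rewrite /quad_fun mulmxBr mulmxDr -!scalemxAr !dotvE yAx; by field.
Qed.

Lemma psd_quad_fun_Gamma0 : (forall x, 0 <= dotv x (A *m x)) ->
  Gamma0 (fun x => (quad_fun A b c x)%:E).
Proof.
move=> psd; split; first by split=> // ; exists 0.
split; last by apply: continuous_lsc; exact: continuous_quad_fun.
move=> x y t /andP[t0 t1]; rewrite -!EFinM -EFinD lee_fin quad_fun_convex_comb.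
by rewrite lerDl mulr_ge0 // divr_ge0 // mulr_ge0 ?subr_ge0 // ltW.
Qed.

(** At the midpoint of [x] and [- x] the convexity defect is a positive multiple of the form at
    [x]. *)
Lemma convex_quad_fun_psd (x : V) :
  convex_fun (fun x => (quad_fun A b c x)%:E) -> 0 <= dotv x (A *m x).
Proof.
have h : 0 < (2^-1 : R) < 1 by lra.
move=> /(_ x (- x) _ h); rewrite -!EFinM -EFinD lee_fin quad_fun_convex_comb.
rewrite lerDl opprK mulmxDr !dotvE; lra.
Qed.

End QuadraticGamma0.

(** * Envelopes of generalized linear-quadratic functions *)

Section PartialQuadratic.
Context {R : realType} {n : nat}.
Local Notation V := 'cV[R]_n.

(** The columns of [P] form a maximal independent family in the domain, which exists because
    [k <= n]. A domain point outside their span could be appended as a new column. *)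
Lemma linear_relation_param (G : @relation R n) : linear_relation G ->
  exists k (P P' : 'M[R]_(n, k)),
    [/\ forall u, G (P *m u) (P' *m u), forall u : 'cV_k, P *m u = 0 -> u = 0
      & forall x x', G x x' -> exists u, x = P *m u].
Proof.
move=> [G0 [GD GZ]].
pose good k := exists P P' : 'M[R]_(n, k),
  (forall u, G (P *m u) (P' *m u)) /\ (forall u : 'cV_k, P *m u = 0 -> u = 0).
have good0 : exists k, `[< good k >].
  exists 0%N; apply/asboolP; exists 0, 0; split=> u; first by rewrite !mul0mx.
  by rewrite [u]flatmx0.
have goodn k : `[< good k >] -> (k <= n)%N.
  move=> /asboolP[P [_ [_ Pinj]]].
  have /eqP <- : row_free P^T; last exact: rank_leq_col.
  apply: inj_row_free => v vP; apply: trmx_inj; rewrite trmx0.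
  by apply: Pinj; rewrite -[P]trmxK -trmx_mul vP trmx0.
case: (ex_maxnP good0 goodn) => k /asboolP[P [P' [GP Pinj]]] kmax.
exists k, P, P'; split=> // x x' Gx; apply: contrapT => xP.
suff : `[< good (k + 1)%N >] by move/kmax; rewrite addn1 ltnn.
apply/asboolP; exists (row_mx P x), (row_mx P' x'); split=> u.
  rewrite -[u]vsubmxK !mul_row_col [dsubmx u]mx11_scalar !mul_mx_scalar.
  by apply: GD => //; exact: GZ.
rewrite -[u]vsubmxK mul_row_col [dsubmx u]mx11_scalar mul_mx_scalar.
set s := dsubmx u 0 0 => Pxu.
(* A nonzero last coordinate would express [x] through the columns of [P]. *)
have s0 : s = 0.
  apply/eqP/negPn/negP => s0; apply: xP; exists (- s^-1 *: usubmx u).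
  rewrite -scalemxAr; move/eqP: Pxu; rewrite addr_eq0 => /eqP ->.
  by rewrite scaleNr scalerN opprK scalerA mulVf // scale1r.
rewrite s0 scale0r addr0 in Pxu *.
by rewrite (Pinj _ Pxu) -scalemx1 scale0r col_mx0.
Qed.

(** The objective is quadratic in [u] with Hessian [N], positive definite because [P] is injective.
    Completing the square at the minimiser [u0 y] leaves a form in [y], nonnegative as a value of a
    nonnegative objective. *)
Lemma subspace_quadratic_env k (P P' : 'M[R]_(n, k)) (r : R) : 0 < r ->
  (forall u, 0 <= dotv (P *m u) (P' *m u)) ->
  (forall u : 'cV_k, P *m u = 0 -> u = 0) ->
  exists A : 'M[R]_n, [/\ A^T = A, forall x, 0 <= dotv x (A *m x) & forall y,
    (forall u, 1 / 2 * dotv y (A *m y)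
       <= 1 / 2 * dotv (P *m u) (P' *m u) + r / 2 * sqnorm (P *m u - y)) /\
    exists u, 1 / 2 * dotv y (A *m y)
       = 1 / 2 * dotv (P *m u) (P' *m u) + r / 2 * sqnorm (P *m u - y)].
Proof.
move=> r0 Pmon Pinj.
pose N := 2^-1 *: (P^T *m P' + P'^T *m P) + r *: (P^T *m P).
have NE u v : dotv u (N *m v) =
    2^-1 * (dotv (P *m u) (P' *m v) + dotv (P' *m u) (P *m v))
    + r * dotv (P *m u) (P *m v).
  by rewrite mulmxDl -!scalemxAl mulmxDl -!mulmxA !dotvE !dotv_mulmxl.
have Nuu u : dotv u (N *m u) = dotv (P *m u) (P' *m u) + r * sqnorm (P *m u).
  by rewrite NE (dotvC (P' *m u)) /sqnorm; field.
have N0 u : 0 <= dotv u (N *m u).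
  by rewrite Nuu addr_ge0 // mulr_ge0 ?dotv_ge0 // ltW.
have symN : N^T = N.
  rewrite /N !(linearD, linearZ) /= !trmx_mul !trmxK -scalerDr.
  by rewrite [P'^T *m P + _]addrC.
have unitN : N \in unitmx.
  rewrite -row_free_unit; apply: inj_row_free => v vN; apply: trmx_inj.
  rewrite trmx0; apply: Pinj; apply: dotv_eq0; apply/eqP.
  have : dotv v^T (N *m v^T) = 0 by rewrite -symN -trmx_mul vN trmx0 dotv0r.
  rewrite Nuu => /eqP; rewrite paddr_eq0 ?mulr_ge0 ?dotv_ge0 ?(ltW r0) //.
  by rewrite mulf_eq0 (gt_eqF r0) => /andP[].
(* This is the Schur complement of [N] in the joint quadratic form in [u] and [y]. *)
pose A := r%:M - r ^+ 2 *: (P *m invmx N *m P^T).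
have symA : A^T = A.
  rewrite /A linearB linearZ /= tr_scalar_mx !trmx_mul trmxK trmx_inv symN.
  by rewrite mulmxA.
pose u0 (y : V) := r *: (invmx N *m (P^T *m y)).
have sq u y : 1 / 2 * dotv (P *m u) (P' *m u) + r / 2 * sqnorm (P *m u - y)
    = 1 / 2 * dotv y (A *m y) + 1 / 2 * dotv (u - u0 y) (N *m (u - u0 y)).
  have Nu0 : N *m u0 y = r *: (P^T *m y).
    by rewrite -scalemxAr mulKVmx.
  have yAy : dotv y (A *m y) = r * dotv y y - r * dotv (P *m u0 y) y.
    rewrite mulmxBl mul_scalar_mx -scalemxAl !dotvE -!mulmxA.
    by rewrite -[P *m u0 y]scalemxAr dotvZl (dotvC _ y); ring.
  have e1 : dotv (u0 y) (N *m u) = r * dotv (P *m u) y.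
    by rewrite -{1}symN -dotv_mulmxl Nu0 dotvZl dotvC dotv_mulmxl.
  move: (u0 y) Nu0 yAy e1 => w Nu0 -> e1.
  rewrite mulmxBr !dotvE Nuu e1 Nu0 !dotvE -!dotv_mulmxl /sqnorm !dotvE.
  by rewrite (dotvC y (P *m u)); field.
exists A; split=> // [x|y].
  have := sq (u0 x) x; rewrite subrr dotv0l mulr0 addr0 => E.
  have : 0 <= 1 / 2 * dotv x (A *m x).
    by rewrite -E addr_ge0 ?mulr_ge0 ?dotv_ge0 ?divr_ge0 ?(ltW r0).
  by lra.
split=> [u|]; first by rewrite sq lerDl mulr_ge0 ?divr_ge0.
by exists (u0 y); rewrite sq subrr dotv0l mulr0 addr0.
Qed.

Lemma gen_lin_quad_moreau_env (r : R) (f : V -> \bar R) : 0 < r ->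
  gen_lin_quad f -> exists (A : 'M[R]_n) (b : V) (c : R), sym_psd A /\
    forall x, moreau_env r f x = (quad_fun A b c x)%:E.
Proof.
move=> r0 [G [a [b [c [Glin [Gmon fE]]]]]].
have rn0 : r != 0 by rewrite gt_eqF.
have [k [P [P' [GP Pinj Gdom]]]] := linear_relation_param _ Glin.
have Pmon u : 0 <= dotv (P *m u) (P' *m u).
  by have := Gmon _ _ _ _ (GP u) Glin.1; rewrite !subr0 dotvC.
have [A [symA psdA envA]] := subspace_quadratic_env _ P P' r r0 Pmon Pinj.
pose h := a + r^-1 *: b.
exists A, (b - A *m h), (c - 1 / (2 * r) * sqnorm b + 1 / 2 * dotv h (A *m h)).
have shift (g x : V) (t : R) :
    quad_fun A (b - A *m g) (t + 1 / 2 * dotv g (A *m g)) x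
    = 1 / 2 * dotv (x - g) (A *m (x - g)) + (dotv b x + t).
  have gAx : dotv g (A *m x) = dotv x (A *m g) by rewrite dotvC dotv_mulmxl symA.
  by rewrite /quad_fun mulmxBr !dotvE gAx (dotvC (A *m g)); field.
split=> // x; rewrite shift.
(* completing the square absorbs the linear term of [f] in the shift [h] *)
have objE (u : 'cV_k) : (f (P *m u + a)%R + (r / 2 * sqnorm (P *m u + a - x))%:E)%E =
   (1 / 2 * dotv (P *m u) (P' *m u) + r / 2 * sqnorm (P *m u - (x - h))
     + (dotv b x + (c - 1 / (2 * r) * sqnorm b)))%:E.
  rewrite fE addrK (@qrel_dom _ _ G _ (P' *m u)) //; last first.
    by move=> x1 x2; exact: monotone_dotv_uniq.
  rewrite -!EFinD; congr (_%:E); rewrite /sqnorm /h.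
  move: (P *m u) (P' *m u) => p p'.
  by rewrite !dotvE !(dotvC _ b) !(dotvC _ x) !(dotvC _ a); field.
have [lb [u uE]] := envA (x - h).
apply: moreau_env_eq => [y|]; last by exists (P *m u + a); rewrite objE uE.
have [[y' /Gdom[v yE]]|yN] := pselect (exists y', G (y - a) y').
  have -> : y = P *m v + a by rewrite -yE addrNK.
  by rewrite objE lee_fin lerD2r.
by rewrite fE qrel_out // !addye // leey.
Qed.

End PartialQuadratic.

Theorem theorem4p50 (R : realType) (n : nat) (r : R) (f : 'cV[R]_n -> \bar R) :
  0 < r -> Gamma0 f ->
  (gen_lin_quad f <->
     (Gamma0 (moreau_env r f) /\
      exists (A : 'M[R]_n) (b : 'cV[R]_n) (c : R), A^T = A /\
        forall x, moreau_env r f x = (quad_fun A b c x)%:E))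
  /\
  (forall (A : 'M[R]_n) (b : 'cV[R]_n) (c : R), sym_psd A ->
     ((forall x, moreau_env r f x = (quad_fun A b c x)%:E) <->
      (forall x, f x =
         (qrel (rel_inv (rel_add (rel_inv (mx_rel A))
                                 (rel_scale (- r^-1) rel_id)))
               (x + r^-1 *: b)
          + (dotv b x + c + (1 / (2 * r)) * sqnorm b)%:E)%E))).
Proof.
move=> r0 Gf; have [fprop [fconv flsc]] := Gf.
split; last first.
  move=> A b c [symA psdA]; split=> [eE|fE].
    exact: moreau_env_genquad.
  exact: genquad_moreau_env.
split=> [/(gen_lin_quad_moreau_env _ _ r0)[A [b [c [[symA psdA] eE]]]]|].
  split; last by exists A, b, c.
  by rewrite (funext eE); exact: psd_quad_fun_Gamma0.
move=> [[_ [econv _]] [A [b [c [symA eE]]]]].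
(* Semidefiniteness comes from the convexity of the envelope. *)
have psdA x : 0 <= dotv x (A *m x).
  by apply: (convex_quad_fun_psd A b c symA); rewrite -(funext eE).
have fE := moreau_env_genquad _ _ _ _ _ r0 symA psdA flsc eE.
exists (rel_inv (rel_add (rel_inv (mx_rel A)) (rel_scale (- r^-1) rel_id))).
exists (- (r^-1 *: b)), b, (c + 1 / (2 * r) * sqnorm b).
split; first exact: res_rel_linear.
split; last by move=> x; rewrite fE opprK addrA.
(* By linearity, monotonicity reduces to the single parameter [z - w], where convexity of [f] gives
   it. *)
move=> x x' y y' /res_relP[z -> ->] /res_relP[w -> ->].
rewrite -mulmxBr dotvC.
have := convex_res_monotone _ _ _ _ _ r0 symA (z - w) fconv fE.
by rewrite mulmxBr scalerBr !opprD addrACA.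
Qed.
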